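(* Let $G$ be a finite group, let $K\subset G$ be a normal subgroup, and let $K\subsetneq L\subsetneq H\subsetneq G$ be a chain of subgroups of $G$. Then the $G$-transfer system $\langle (K,H)\rangle$ generated by the pair $(K,H)$ is not realized by a $G$-Steiner operad or a $G$-linear isometries operad; that is, for every $G$-universe $U$, $\langle (K,H)\rangle\neq\ \to_{\mathcal{K}(U)}$ and $\langle (K,H)\rangle\neq\ \to_{\mathcal{L}(U)}$.
   Context: Let $G$ be a finite group and $\mathrm{Sub}(G)$ its set of subgroups. A $G$-transfer system is a partial order $\to$ on $\mathrm{Sub}(G)$ such that: if $K\to H$ then $K\subset H$; if $K\to H$ then $gKg^{-1}\to gHg^{-1}$ for all $g\in G$; if $K\to H$ and $L\subset H$ then $K\cap L\to L$. For a binary relation $R$ on $\mathrm{Sub}(G)$ refining inclusion (identified with its set of related pairs), $\langle R\rangle$ is the smallest $G$-transfer system containing $R$. A $G$-universe is a countably infinite dimensional real inner product space $U$ with a linear isometric $G$-action, which contains each of its (finite dimensional) subrepresentations infinitely often, and which contains trivial summands. Linear isometries operad: $\mathcal{L}(U)(n)$ is the $G\times\Sigma_n$-space of all linear, not necessarily equivariant, isometries $U^{\oplus n}\hookrightarrow U$ ($G$ acts by conjugation, $\Sigma_n$ by permuting summands). Steiner operad: for a finite dimensional real orthogonal $G$-representation $V$, let $R_V$ be the $G$-space (under conjugation) of distance-reducing, not necessarily equivariant, embeddings $V\to V$. A $V$-Steiner path is a map $h:[0,1]\to R_V$ with $h(1)=\mathrm{id}$, and $\mathcal{K}(V)(n)$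 is the $G\times\Sigma_n$-space of $n$-tuples $(h_1,\dots,h_n)$ of $V$-Steiner paths such that the images of $h_1(0),\dots,h_n(0)$ are disjoint. Set $\mathcal{K}(U)=\mathrm{colim}_{V\subset U}\mathcal{K}(V)$, over finite dimensional subrepresentations $V\subset U$ (for $V\subset W$ one takes the product with the identity on the orthogonal complement of $V$ in $W$). For $\mathcal{O}=\mathcal{K}(U)$ or $\mathcal{L}(U)$ and $K\subset H\subset G$ with $n=|H:K|$, let $\Gamma(H/K)=\{(h,\sigma(h))\mid h\in H\}\subset G\times\Sigma_n$ be the graph of a permutation representation $\sigma:H\to\Sigma_n$ of $H/K$. The transfer system $\to_{\mathcal{O}}$ is defined by: $K\to_{\mathcal{O}}H$ iff $K\subset H$ and $\mathcal{O}(n)^{\Gamma(H/K)}\neq\varnothing$. By known theorems of Blumberg and Hill, for $K\subset H$: $K\to_{\mathcal{K}(U)}H$ iff there is an injective $H$-equivariant map of sets $H/K\hookrightarrow\mathrm{res}^G_HU$, and $K\to_{\mathcal{L}(U)}H$ iff there is an $H$-equivariant linear embedding $\mathrm{ind}_K^H\mathrm{res}^G_KU\hookrightarrow\mathrm{res}^G_HU$. *)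

(* Defs.v *)
From HB Require Import structures.
From mathcomp Require Import all_boot all_order all_algebra all_fingroup.
From mathcomp Require Import sesquilinear.
From mathcomp Require Import all_classical all_reals all_analysis.
From Stdlib Require Import Relation_Operators.

Set Implicit Arguments.
Unset Strict Implicit.
Unset Printing Implicit Defensive.

Import Order.TTheory GRing.Theory Num.Theory.
Import numFieldNormedType.Exports.

Local Open Scope classical_set_scope.
Local Open Scope ring_scope.

(* The finite group G is [gT] itself, so that Sub(G) is [{group gT}]. *)

Definition sub_rel (gT : finGroupType) := {group gT} -> {group gT} -> Prop.

(* [A :^ g] is g^-1 A g in MathComp, hence [:^ g^-1] for conjugation by g. *)
Record is_transfer_system (gT : finGroupType) (T : sub_rel gT) : Prop :=
  IsTransferSystem {
    ts_refl : forall H, T H H;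
    ts_anti : forall K H, T K H -> T H K -> K = H;
    ts_trans : forall L K H, T L K -> T K H -> T L H;
    ts_sub : forall K H, T K H -> K \subset H;
    ts_conj : forall K H (g : gT), T K H -> T (K :^ g^-1)%G (H :^ g^-1)%G;
    ts_res : forall K H L : {group gT}, T K H -> L \subset H ->
      T (K :&: L)%G L }.

Definition generated_ts (gT : finGroupType) (S : sub_rel gT) : sub_rel gT :=
  fun A B => forall T : sub_rel gT, is_transfer_system T ->
    (forall C D, S C D -> T C D) -> T A B.

Definition pair_rel (gT : finGroupType) (K H : {group gT}) : sub_rel gT :=
  fun A B => A = K /\ B = H.

Lemma subset_transfer_system (gT : finGroupType) :
  is_transfer_system (fun K H : {group gT} => is_true (K \subset H)).
Proof.
split => //.
- move=> K H KH HK; apply/val_inj/eqP.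
  by rewrite finset.eqEsubset KH HK.
- by move=> L K H LK KH; exact: fintype.subset_trans LK KH.
- by move=> K H g KH; rewrite /= conjSg.
- by move=> K H L _ _; exact: finset.subsetIr.
Qed.

Lemma generated_transfer_system (gT : finGroupType) (S : sub_rel gT) :
    (forall K H, S K H -> K \subset H) ->
  [/\ is_transfer_system (generated_ts S),
      forall K H, S K H -> generated_ts S K H
    & forall T, is_transfer_system T -> (forall K H, S K H -> T K H) ->
        forall K H, generated_ts S K H -> T K H].
Proof.
move=> Ssub; split; last 2 first.
- by move=> K H SKH T _; apply.
- by move=> T tT ST K H; apply.
have gsub K H : generated_ts S K H -> K \subset H.
  by move/(_ _ (subset_transfer_system gT)); apply.
split => //.
- by move=> H T tT _; exact: ts_refl tT _.
- move=> K H /gsub KH /gsub HK; apply/val_inj/eqP.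
  by rewrite finset.eqEsubset KH HK.
- move=> L K H LK KH T tT ST.
  exact: (@ts_trans _ _ tT _ K _ (LK _ tT ST) (KH _ tT ST)).
- by move=> K H g KH T tT ST; exact: (@ts_conj _ _ tT _ _ g (KH _ tT ST)).
- by move=> K H L KH LH T tT ST; exact: (@ts_res _ _ tT _ _ _ (KH _ tT ST) LH).
Qed.

(* Left actions, Sigma_n being the group of permutations under composition of
   functions: in MathComp the composite [s \o t] is [t * s]. *)
Record gsym_seq (gT : finGroupType) := GsymSeq {
  gs_car :> nat -> Type;
  gs_act : forall n, gT -> 'S_n -> gs_car n -> gs_car n;
  gs_act1 : forall n (x : gs_car n), gs_act 1%g 1%g x = x;
  gs_actM : forall n g h (s t : 'S_n) (x : gs_car n),
    gs_act (g * h)%g (t * s)%g x = gs_act g s (gs_act h t x) }.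

(* [s] is the permutation representation obtained from the left action of H
   on the left cosets H/K through some numbering [e] of these cosets. *)
Definition coset_perm_rep (gT : finGroupType) (K H : {group gT})
    (s : gT -> 'S_(#|H : K|%g)) : Prop :=
  exists e : 'I_(#|H : K|%g) -> {set gT},
    [/\ injective e, e @: [set: 'I_(#|H : K|%g)]%SET = lcosets K H
      & forall h, h \in H -> forall i, e (s h i) = (h *: e i)%g].

Definition transfer_of (gT : finGroupType) (O : gsym_seq gT) : sub_rel gT :=
  fun K H => K \subset H /\
    exists s : gT -> 'S_(#|H : K|%g), coset_perm_rep s /\
      exists x : O #|H : K|%g, forall h, h \in H -> gs_act h (s h) x = x.

Record orep (R : realType) (gT : finGroupType) := Orep {
  orep_car :> normedModType R;
  dot : {dot orep_car for idfun};
  rep_act : gT -> {linear orep_car -> orep_car};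
  dot_norm : forall u, dot u u = `|u| ^+ 2;
  rep_act1 : forall u, rep_act 1%g u = u;
  rep_actM : forall g h u, rep_act (g * h)%g u = rep_act g (rep_act h u);
  rep_act_isom : forall g u v, dot (rep_act g u) (rep_act g v) = dot u v }.

Arguments rep_act {R gT} {_} _.
Arguments rep_act_isom {R gT} {_} _ _ _.

Record subrep (R : realType) (gT : finGroupType) (U : orep R gT) := Subrep {
  sr_set :> set U;
  sr_findim : exists n (e : 'I_n -> U),
    sr_set = [set \sum_i c i *: e i | c in [set: 'I_n -> R]];
  sr_act : forall g v, sr_set v -> sr_set (rep_act g v) }.

(* In [univ_inf] the maps [phi i] are taken to be defined on all of U, which is
   no restriction as a linear map on the subspace V extends to U; only their
   values on V matter, and these form an isometric equivariant embedding of the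
   countable direct sum of copies of V. *)
Record is_universe (R : realType) (gT : finGroupType) (U : orep R gT) : Prop :=
  IsUniverse {
    univ_dim : exists e : nat -> U,
      (forall n (c : 'I_n -> R), \sum_(i < n) c i *: e i = 0 ->
         forall i, c i = 0) /\
      (forall u, exists n (c : 'I_n -> R), u = \sum_(i < n) c i *: e i);
    univ_inf : forall V : subrep U, exists phi : nat -> {linear U -> U},
      (forall i g v, sr_set V v -> phi i (rep_act g v) = rep_act g (phi i v)) /\
      (forall i j v w, sr_set V v -> sr_set V w ->
         dot U (phi i v) (phi j w) = if i == j then dot U v w else 0);
    univ_triv : exists u : U, u != 0 /\ forall g, rep_act g u = u }.

Section OrepFacts.
Variables (R : realType) (gT : finGroupType) (U : orep R gT).
Implicit Types (g : gT) (u v : U).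

Lemma rep_actK g : cancel (@rep_act _ _ U g) (rep_act g^-1%g).
Proof. by move=> u; rewrite -rep_actM mulVg rep_act1. Qed.

Lemma rep_actVK g : cancel (@rep_act _ _ U g^-1%g) (rep_act g).
Proof. by move=> u; rewrite -rep_actM mulgV rep_act1. Qed.

Lemma rep_act_norm g u : `|rep_act g u| = `|u|.
Proof.
apply/eqP; rewrite -(@eqrXn2 _ 2)//; apply/eqP.
by rewrite -!dot_norm rep_act_isom.
Qed.

Lemma rep_act_continuous g : continuous (@rep_act _ _ U g).
Proof.
move=> u; apply/cvgrPdist_lt => eps eps0.
near=> v.
rewrite -linearB rep_act_norm; near: v.
by move/cvgrPdist_lt : (@cvg_id _ (nbhs u)); exact.
Unshelve. all: by end_near. Qed.

End OrepFacts.

Section LinearIsometries.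
Variables (R : realType) (gT : finGroupType) (U : orep R gT).

Definition lin_isom n : set ({ffun 'I_n -> U} -> U) :=
  [set f : {ffun 'I_n -> U} -> U | linear f /\
    forall u v : {ffun 'I_n -> U},
      dot U (f u) (f v) = \sum_i dot U (u i) (v i)].
#[local] Arguments lin_isom n : clear implicits.

(* The permutation tau acts on n-tuples by (tau u)_(tau i) = u_i, and (g, tau)
   acts on f by conjugation with the resulting action of (g, tau) on tuples. *)
Lemma lin_isom_act_subproof n g (tau : 'S_n) (f : lin_isom n) :
  (fun u : {ffun 'I_n -> U} =>
     rep_act g (val f [ffun i => rep_act g^-1%g (u (tau i))]))
    \in lin_isom n.
Proof.
have [flin fdot] := set_mem (valP f); rewrite inE; split=> [a u v|u v].
  rewrite -linearP -flin; congr (rep_act g (val f _)).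
  by apply/ffunP => i; rewrite !ffunE linearP.
rewrite rep_act_isom fdot [RHS](reindex_inj (@perm_inj _ tau)).
by apply: eq_bigr => i _; rewrite !ffunE rep_act_isom.
Qed.

Definition lin_isom_act n g (tau : 'S_n) (f : lin_isom n) :
  lin_isom n :=
  exist (fun f => f \in lin_isom n) _ (lin_isom_act_subproof g tau f).

Lemma lin_isom_act1 n (f : lin_isom n) : lin_isom_act 1%g 1%g f = f.
Proof.
apply: val_inj; apply/funext => u /=; rewrite rep_act1; congr (val f _).
by apply/ffunP => i; rewrite ffunE perm1 invg1 rep_act1.
Qed.

Lemma lin_isom_actM n g h (s t : 'S_n) (f : lin_isom n) :
  lin_isom_act (g * h)%g (t * s)%g f = lin_isom_act g s (lin_isom_act h t f).
Proof.
apply: val_inj; apply/funext => u /=; rewrite rep_actM.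
do 2!congr (rep_act _ _).
by congr (val f _); apply/ffunP => i; rewrite !ffunE permM invMg rep_actM.
Qed.

Definition linear_isometries_operad : gsym_seq gT :=
  GsymSeq lin_isom_act1 lin_isom_actM.

End LinearIsometries.

Arguments lin_isom {R gT} U n.

Section Steiner.
Variables (R : realType) (gT : finGroupType) (U : orep R gT).

Definition unit_itv : set R := `[0%R, 1%R].

Lemma unit_itv0_subproof : (0 : R) \in unit_itv.
Proof. by rewrite inE /unit_itv /= in_itv /= lexx ler01. Qed.

Lemma unit_itv1_subproof : (1 : R) \in unit_itv.
Proof. by rewrite inE /unit_itv /= in_itv /= lexx ler01. Qed.

Definition I0 : unit_itv := exist _ 0 unit_itv0_subproof.
Definition I1 : unit_itv := exist _ 1 unit_itv1_subproof.

Implicit Types V W : subrep U.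

(* Below, the type [V] is the subset [V] of [U] with its subspace topology. *)

Lemma subact_subproof V g (v : V) : rep_act g (val v) \in (V : set U).
Proof. by rewrite inE; apply: sr_act; exact/set_mem/(valP v). Qed.

Definition subact V g (v : V) : V :=
  exist (fun u => u \in (V : set U)) _ (subact_subproof g v).

Definition topological_embedding (X Y : topologicalType) (f : X -> Y) : Prop :=
  [/\ injective f, continuous f
    & forall A : set X, open A -> exists B : set Y, open B /\ A = f @^-1` B].

(* "Distance-reducing" is meant in the weak sense, so that the identity map is
   allowed as an end point of Steiner paths. *)
Definition distance_reducing V (f : V -> V) : Prop :=
  forall v w : V, `|val (f v) - val (f w)| <= `|val v - val w|.

Definition embR V : set (V -> V) :=
  [set f | topological_embedding f /\ distance_reducing f].

Definition steiner_path V : set (unit_itv -> V -> V) :=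
  [set h | [/\ forall t, embR (h t),
               continuous (h : unit_itv -> {compact-open, V -> V})
             & h I1 = id]].

Definition steiner V n : set ('I_n -> unit_itv -> V -> V) :=
  [set h | (forall i, steiner_path (h i)) /\
           trivIset setT (fun i => range (h i I0))].
#[local] Arguments steiner V n : clear implicits.

Lemma subactK V g : cancel (@subact V g) (subact g^-1%g).
Proof. by move=> v; apply: val_inj; rewrite /= rep_actK. Qed.

Lemma subactVK V g : cancel (@subact V g^-1%g) (subact g).
Proof. by move=> v; apply: val_inj; rewrite /= rep_actVK. Qed.

Lemma subact_continuous V g : continuous (@subact V g).
Proof.
apply: continuous_comp_initial => v.
apply: (@continuous_comp _ _ _ set_val (rep_act g)).
  exact: initial_continuous.
exact: rep_act_continuous.
Qed.

Lemma embR_conj V g (f : V -> V) : embR f ->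
  embR (fun v => subact g (f (subact g^-1%g v))).
Proof.
move=> [[finj fcont fopen] fdist]; split; last first.
  move=> v w; rewrite /= -linearB rep_act_norm.
  by apply: le_trans (fdist _ _) _; rewrite /= -linearB rep_act_norm.
have gc (h : gT) : continuous (@subact V h) by exact: subact_continuous.
split.
- move=> v w /(can_inj (@subactK V g))/finj.
  exact: (can_inj (@subactVK V g)).
- move=> v; apply: (@continuous_comp _ _ _ (subact g^-1%g)
    (fun w => subact g (f w))); first exact: gc.
  by apply: continuous_comp; [exact: fcont|exact: gc].
- move=> A oA.
  have oA' : open (subact g @^-1` A) by move/continuousP : (gc g); exact.
  have [B [oB AB]] := fopen _ oA'.
  exists (subact g^-1%g @^-1` B); split.
    by move/continuousP : (gc g^-1%g); exact.
  apply/seteqP; split=> v /=.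
    rewrite subactK => Av; have : (f @^-1` B) (subact g^-1%g v).
      by rewrite -AB /= subactVK.
    by [].
  rewrite subactK => Bv; have : (subact g @^-1` A) (subact g^-1%g v).
    by rewrite AB.
  by rewrite /= subactVK.
Qed.

Lemma steiner_path_conj V g (h : unit_itv -> V -> V) : steiner_path h ->
  steiner_path (fun t v => subact g (h t (subact g^-1%g v))).
Proof.
move=> [hR hcont h1]; split.
- by move=> t; exact/embR_conj.
- move=> t.
  have FF (f : unit_itv -> V -> V) : Filter (f @ t).
    by exact: fmap_filter (nbhs_filter t).
  apply/(compact_open_cvgP _ (FF _)) => K O cK oO KO.
  have cK' : compact (subact g^-1%g @` K).
    apply: continuous_compact => //; apply: continuous_subspaceT.
    exact: subact_continuous.
  have oO' : open (subact g @^-1` O).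
    by move/continuousP : (@subact_continuous V g); exact.
  have /(compact_open_cvgP _ (FF _)) hct := hcont t.
  have KO' : h t @` (subact g^-1%g @` K) `<=` subact g @^-1` O.
    by move=> _ [_ [v Kv <-] <-] /=; apply: KO; exists v.
  have := hct _ _ cK' oO' KO'.
  apply: (@filterS _ _ (nbhs_filter t)) => t' /= KO'' _ [v Kv <-].
  by apply: KO''; exists (subact g^-1%g v) => //; exists v.
- by rewrite h1; apply/funext => v; rewrite subactVK.
Qed.

(* (g, tau) sends (h_1, ..., h_n) to the tuple with g h_i g^-1 at place
   tau i. *)
Lemma steiner_act_subproof V n g (tau : 'S_n) (h : steiner V n) :
  (fun i t v => subact g (val h (tau^-1 i)%g t (subact g^-1%g v)))
    \in steiner V n.
Proof.
have [hpath hdisj] := set_mem (valP h); rewrite inE; split=> [i|i j _ _].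
  exact/steiner_path_conj.
move=> [_ [[v _ <-] [w _ /(can_inj (@subactK V g)) E]]].
apply: (@perm_inj _ tau^-1%g); apply: hdisj => //.
by exists (val h (tau^-1 i)%g I0 (subact g^-1%g v)); split;
  [exists (subact g^-1%g v)|exists (subact g^-1%g w)].
Qed.

Definition steiner_act V n g (tau : 'S_n) (h : steiner V n) :
  steiner V n :=
  exist (fun h => h \in steiner V n) _ (steiner_act_subproof g tau h).

(* The disjoint union over V of the sets K(V)(n), whose quotient by the
   equivalence relation generated by the transition maps is the colimit. *)
Record steiner_rep n :=
  SteinerRep { srep_space : subrep U; srep_val : steiner srep_space n }.

HB.instance Definition _ n := gen_eqMixin (steiner_rep n).
HB.instance Definition _ n := gen_choiceMixin (steiner_rep n).

(* [y] is the image of [x] under the transition map for V `<=` W: a point u of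
   W is v + w with v in V and w in W orthogonal to V, and the product with the
   identity sends v + w to h(v) + w. *)
Definition steiner_extends n (x y : steiner_rep n) : Prop :=
  (srep_space x `<=` srep_space y) /\
  forall i t (v : srep_space x) (w u : srep_space y),
    (forall v' : srep_space x, dot U (val w) (val v') = 0) ->
    val u = val v + val w ->
    val (val (srep_val y) i t u) = val (val (srep_val x) i t v) + val w.

Definition steiner_eqv n : rel (steiner_rep n) :=
  fun x y => `[< clos_refl_sym_trans _ (@steiner_extends n) x y >].

Lemma steiner_eqv_refl n : reflexive (@steiner_eqv n).
Proof. by move=> x; apply/asboolP; exact: rst_refl. Qed.

Lemma steiner_eqv_sym n : symmetric (@steiner_eqv n).
Proof. by move=> x y; apply/asboolP/asboolP; exact: rst_sym. Qed.

Lemma steiner_eqv_trans n : transitive (@steiner_eqv n).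
Proof. by move=> y x z /asboolP xy /asboolP yz; apply/asboolP/rst_trans/yz. Qed.

Canonical steiner_eqv_rel n := EquivRel (@steiner_eqv n)
  (@steiner_eqv_refl n) (@steiner_eqv_sym n) (@steiner_eqv_trans n).

Definition steiner_colim n := {eq_quot (@steiner_eqv_rel n)}%qT.

Definition steiner_rep_act n g (tau : 'S_n) (x : steiner_rep n) :
  steiner_rep n := SteinerRep (steiner_act g tau (srep_val x)).

Definition steiner_colim_act n g (tau : 'S_n) (q : steiner_colim n) :
  steiner_colim n :=
  \pi_(steiner_colim n)%qT (steiner_rep_act g tau (generic_quotient.repr q)).

Lemma steiner_extends_act n g (tau : 'S_n) (x y : steiner_rep n) :
  steiner_extends x y ->
  steiner_extends (steiner_rep_act g tau x) (steiner_rep_act g tau y).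
Proof.
move=> [xy E]; split=> // i t v w u wv uvw /=.
rewrite (E _ _ (subact g^-1%g v) (subact g^-1%g w)).
- by rewrite linearD /= rep_actVK.
- move=> v' /=; rewrite -(rep_act_isom g) rep_actVK.
  exact: (wv (subact g v')).
- by rewrite /= uvw linearD.
Qed.

Lemma steiner_colim_actE n g (tau : 'S_n) (x : steiner_rep n) :
  steiner_colim_act g tau (\pi_(steiner_colim n)%qT x) =
  \pi_(steiner_colim n)%qT (steiner_rep_act g tau x).
Proof.
have act_eqv y z : clos_refl_sym_trans _ (@steiner_extends n) y z ->
    clos_refl_sym_trans _ (@steiner_extends n)
      (steiner_rep_act g tau y) (steiner_rep_act g tau z).
  elim=> [a b ab|a|a b _ IH|a b c _ IH1 _ IH2].
  - exact/rst_step/steiner_extends_act.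
  - exact: rst_refl.
  - exact: rst_sym.
  - exact: rst_trans IH1 IH2.
apply/eqmodP/asboolP/act_eqv/asboolP.
by apply/(@eqmodP _ (steiner_eqv_rel n)); rewrite reprK.
Qed.

Lemma steiner_colim_act1 n (q : steiner_colim n) :
  steiner_colim_act 1%g 1%g q = q.
Proof.
elim/(@quotW _ (steiner_colim n)): q => -[V h].
rewrite steiner_colim_actE /steiner_rep_act /=.
suff -> : steiner_act 1%g 1%g h = h by []; apply: val_inj.
apply/funext => i; apply/funext => t; apply/funext => v; apply: val_inj.
rewrite /= rep_act1 !invg1 perm1; congr (val (val h i t _)).
by apply: val_inj; rewrite /= rep_act1.
Qed.

Lemma steiner_colim_actM n g h (s t : 'S_n) (q : steiner_colim n) :
  steiner_colim_act (g * h)%g (t * s)%g q =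
  steiner_colim_act g s (steiner_colim_act h t q).
Proof.
elim/(@quotW _ (steiner_colim n)): q => -[V k].
rewrite !steiner_colim_actE /steiner_rep_act /=.
suff -> : steiner_act (g * h)%g (t * s)%g k =
  steiner_act g s (steiner_act h t k) by []; apply: val_inj.
apply/funext => i; apply/funext => r; apply/funext => v; apply: val_inj.
rewrite /= rep_actM !invMg permM.
congr (rep_act _ (rep_act _ (val (val k _ _ _)))).
by apply: val_inj; rewrite /= rep_actM.
Qed.

Definition steiner_operad : gsym_seq gT :=
  GsymSeq steiner_colim_act1 steiner_colim_actM.

End Steiner.

Arguments steiner {R gT U} V n.

(* Main.v *)
Require Import Defs.
From HB Require Import structures.
From mathcomp Require Import all_boot all_order all_algebra all_fingroup.
From mathcomp Require Import sesquilinear.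
From mathcomp Require Import all_classical all_reals all_analysis.
From mathcomp Require Import ring lra.
From Stdlib Require Import Relation_Operators.

Set Implicit Arguments.
Unset Strict Implicit.
Unset Printing Implicit Defensive.

Import Order.TTheory GRing.Theory Num.Theory.
Import numFieldNormedType.Exports.

(** The transfer system generated by one pair [(K, H)] is small: a nontrivial
relation [A -> B] in it forces [A] into a conjugate of [K] and [B] into a
conjugate of [H] ([generated_pairP]).  Operads of the two kinds have transfer
systems with closure properties that such a small system violates.

For a Steiner operad, [K -> H] means that some point [x] of the universe has
stabilizer exactly [K] in [H] ([steiner_transferP]).  Let [S] be the stabilizer
of the same point [x] in the whole group, so that [S] meets [H] in [K].  The
criterion applied to [x] again gives [S -> G].  If this relation is trivial,
[x] is fixed by [G] and [K = H]; otherwise [G] lies in a conjugate of [H] and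
[H = G].

A linear isometries operad has a saturated transfer system: if [K -> H], then
[L -> H] for every [L] between [K] and [H] ([lin_isom_saturated]), because a
tuple indexed by [H/L] can be spread, up to scale, along the fibers of
[H/K -> H/L].  In the generated system [L -> H] would put [L] into a conjugate
of [K], which is too small.

The criterion for Steiner operads needs the Steiner paths themselves.  In one
direction, the images of the origin under the embeddings [h_i(0)] do not change
under the transition maps of the colimit, so a fixed point of the operad yields
an injective equivariant family of points indexed by [H/K].  In the other
direction, the orbit [p_i] of [x] lies in a finite dimensional
subrepresentation, and the paths move linearly from [v |-> p_i + rho v] to the
identity, where [rho] is a radial contraction onto a ball so small that its
translates by the points [p_i] are disjoint.  Everything but the centers [p_i]
is invariant under linear isometries, so the configuration is equivariant. *)

Local Open Scope ring_scope.
Local Open Scope classical_set_scope.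

(** * The transfer system generated by a pair *)

(** The relations allowed by the conclusion form a transfer system: conjugation
moves the two conjugating elements, restriction shrinks both groups, and in a
composite the outer groups are already bounded by the two factors. *)
Lemma generated_pairP (gT : finGroupType) (K H A B : {group gT}) :
    K \subset H -> generated_ts (pair_rel K H) A B ->
  A = B \/ (exists g, A \subset K :^ g)%g /\ (exists g, B \subset H :^ g)%g.
Proof.
move=> KH gAB.
pose T : sub_rel gT := fun A B => A \subset B /\
  (A = B \/ (exists g, A \subset K :^ g)%g /\ (exists g, B \subset H :^ g)%g).
suff tT : is_transfer_system T.
  have /(_ tT) [] // := gAB T.
  move=> _ _ [-> ->]; split=> //; right.
  by split; exists 1%g; rewrite conjsg1.
split.
- by move=> C; split=> //; left.
- move=> C D [CD _] [DC _]; apply/val_inj/eqP.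
  by rewrite finset.eqEsubset CD DC.
- move=> C D E [CD CDP] [DE DEP].
  split; first exact: fintype.subset_trans CD DE.
  case: CDP DEP => [-> //|[CK DH]] [<-|[DK EH]]; by right.
- by move=> C D [].
- move=> C D g [CD CDP]; split; first by rewrite /= conjSg.
  case: CDP => [->|[[x Cx] [y Dy]]]; [by left|right; split].
    by exists (x * g^-1)%g; rewrite /= conjsgM conjSg.
  by exists (y * g^-1)%g; rewrite /= conjsgM conjSg.
- move=> C D E [CD CDP] ED; split; first exact: finset.subsetIr.
  case: CDP => [->|[[x Cx] [y Dy]]].
    by left; apply/val_inj/finset.setIidPr.
  right; split.
    by exists x; apply: fintype.subset_trans Cx; exact: finset.subsetIl.
  by exists y; exact: fintype.subset_trans ED Dy.
Qed.

(** * Permutation representations on cosets *)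

Lemma lcosets_lmul (gT : finGroupType) (K H : {group gT}) (h : gT)
    (A : {set gT}) :
  h \in H -> A \in lcosets K H -> (h *: A)%g \in lcosets K H.
Proof.
move=> hH /lcosetsP[x xH ->]; apply/lcosetsP; exists (h * x)%g.
  exact: groupM.
by rewrite lcosetM.
Qed.

Lemma coset_perm_rep_exists (gT : finGroupType) (K H : {group gT}) :
  exists s : gT -> 'S_(#|H : K|%g), @coset_perm_rep _ K H s.
Proof.
pose e0 (i : 'I_#|H : K|%g) : {set gT} :=
  enum_val (cast_ord (esym (card_lcosets H K)) i).
have e0_inj : injective e0 by move=> i j /enum_val_inj /cast_ord_inj.
have e0P A : A \in lcosets K H -> exists i, e0 i = A.
  move=> AH; exists (cast_ord (card_lcosets H K) (enum_rank_in AH A)).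
  by rewrite /e0 cast_ordK enum_rankK_in.
have e0in i : e0 i \in lcosets K H by exact: enum_valP.
have sP g : exists p : 'S_#|H : K|%g,
    g \in H -> forall i, e0 (p i) = (g *: e0 i)%g.
  have [gH|ngH] := boolP (g \in H); last by exists 1%g.
  have /choice[f fP] : forall i, exists j, e0 j = (g *: e0 i)%g.
    by move=> i; apply: e0P; apply: lcosets_lmul.
  have finj : injective f.
    by move=> i j /(congr1 e0); rewrite !fP => /lcoset_inj /e0_inj.
  by exists (perm finj) => _ i; rewrite permE.
have [s sE] := choice sP; exists s, e0; split=> //.
apply/finset.setP => A; apply/imsetP/idP => [[i _ ->]|/e0P[i <-]] //.
by exists i.
Qed.

(** The projection [H/K -> H/L], expressed in arbitrary numberings of the two
coset spaces: surjective and equivariant. *)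
Lemma coset_perm_rep_mul (gT : finGroupType) (K L H : {group gT})
    (s : gT -> 'S_(#|H : K|%g)) (s' : gT -> 'S_(#|H : L|%g)) :
    K \subset L -> coset_perm_rep s -> coset_perm_rep s' ->
  exists p : 'I_(#|H : K|%g) -> 'I_(#|H : L|%g),
    (forall i, exists j, p j = i) /\
    forall h, h \in H -> forall j, p (s h j) = s' h (p j).
Proof.
move=> KL [e [einj eim eE]] [e' [e'inj e'im e'E]].
have ein j : e j \in lcosets K H.
  by rewrite -eim; apply/imsetP; exists j.
have e'in j : e' j \in lcosets L H.
  by rewrite -e'im; apply/imsetP; exists j.
have mulL j : exists i, e' i = (e j * L)%g.
  have /lcosetsP[x xH ->] := ein j.
  have : (x *: K * L)%g \in lcosets L H.
    apply/lcosetsP; exists x => //.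
    by rewrite -!mulgA (mulSGid KL).
  by rewrite -e'im => /imsetP[i _ ->]; exists i.
have [p pE] := choice mulL; exists p; split=> [i|h hH j]; last first.
  by apply: e'inj; rewrite e'E// !pE eE// !mulgA.
have /lcosetsP[x xH xE] := e'in i.
have : (x *: K)%g \in lcosets K H by apply/lcosetsP; exists x.
rewrite -eim => /imsetP[j _ jE]; exists j.
by apply: e'inj; rewrite pE -jE xE -mulgA (mulSGid KL).
Qed.

(** * Saturation for linear isometries operads *)

Section LinIsom.
Variables (R : realType) (gT : finGroupType) (U : orep R gT).

(** Repeating the entry [u i] over the fiber of [i] multiplies its contribution
to the inner product by the size of that fiber; the factor [c i] undoes this. *)
Lemma lin_isom_pullback n m (p : 'I_n -> 'I_m) (f : {ffun 'I_n -> U} -> U)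
    (c : 'I_m -> R) :
    (forall i, exists j, p j = i) -> lin_isom U n f ->
    (forall i, c i ^+ 2 * #|[pred j | p j == i]|%:R = 1) ->
  lin_isom U m (fun u => f [ffun j => c (p j) *: u (p j)]).
Proof.
move=> p_surj [flin fdot] cE; split=> [a u v|u v].
  rewrite -flin; congr f; apply/ffunP => j; rewrite !ffunE.
  by rewrite scalerDr !scalerA mulrC.
rewrite fdot (partition_big p xpredT)//=; apply: eq_bigr => i _.
under eq_bigr => j /eqP pj.
  rewrite !ffunE pj linearZl_LR linearZr_LR /= mulrA -expr2.
  over.
by rewrite sumr_const -[LHS]mulr_natr mulrAC cE mul1r.
Qed.
End LinIsom.

(** The representation [ind_L^H U] is a summand of [ind_K^H U]; concretely,
precompose the given equivariant isometry with the embedding along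
[H/K -> H/L]. *)
Lemma lin_isom_saturated (R : realType) (gT : finGroupType) (U : orep R gT)
    (K L H : {group gT}) : K \subset L -> L \subset H ->
  transfer_of (linear_isometries_operad U) K H ->
  transfer_of (linear_isometries_operad U) L H.
Proof.
move=> KL LH [KH [s [sP [f fE]]]]; split=> //.
have [s' s'P] := coset_perm_rep_exists L H; exists s'; split=> //.
have [p [p_surj pE]] := coset_perm_rep_mul KL sP s'P.
pose N i := #|[pred j | p j == i]|.
have N_gt0 i : (0 < N i)%N.
  by have [j pj] := p_surj i; apply/card_gt0P; exists j; rewrite inE pj.
(* [s h] maps the fiber of [i] bijectively onto the fiber of [s' h i]. *)
have NE h i : h \in H -> N (s' h i) = N i.
  move=> hH; rewrite /N -[RHS](fintype.card_image (@perm_inj _ (s h))).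
  apply: eq_card => j; rewrite inE.
  apply/eqP/fintype.imageP => /= [pj|[k + ->]].
    exists ((s h)^-1 j)%g; last by rewrite permKV.
    by rewrite inE; apply/eqP/(@perm_inj _ (s' h)); rewrite -pE// permKV.
  by rewrite inE => /eqP <-; rewrite pE.
pose c i : R := (Num.sqrt (N i)%:R)^-1.
have cE i : c i ^+ 2 * (N i)%:R = 1.
  by rewrite exprVn sqr_sqrtr ?ler0n// mulVf// pnatr_eq0 -lt0n.
have f'P := mem_set (lin_isom_pullback p_surj (set_mem (valP f)) cE).
exists (exist (fun f => f \in lin_isom U _) _ f'P) => h hH.
apply: val_inj; apply/funext => u /=.
rewrite -[in RHS](fE h hH) /=; congr (rep_act h (val f _)).
apply/ffunP => j; rewrite !ffunE pE// linearZ /=.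
by rewrite /c NE.
Qed.

(** * A radial contraction of an inner product space *)

Section Radial.
Variables (R : realType) (gT : finGroupType) (U : orep R gT).
Implicit Types (u v w p : U) (t eps : R).

Lemma dotC u v : dot U u v = dot U v u.
Proof. by rewrite hermC expr0 mul1r. Qed.

Lemma dotDl u v w : dot U (u + v) w = dot U u w + dot U v w.
Proof. by rewrite linearDl. Qed.

Lemma dotZl (a : R) u v : dot U (a *: u) v = a * dot U u v.
Proof. by rewrite linearZl_LR. Qed.

Lemma dot_norm_sqrD u v :
  `|u + v| ^+ 2 = `|u| ^+ 2 + `|v| ^+ 2 + dot U u v *+ 2.
Proof.
rewrite -!dot_norm linearDl linearDr linearDr /= (dotC v u) mulr2n.
by ring.
Qed.

Lemma dot_norm_sqrB u v :
  `|u - v| ^+ 2 = `|u| ^+ 2 + `|v| ^+ 2 - dot U u v *+ 2.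
Proof. by rewrite dot_norm_sqrD normrN linearNr mulNrn. Qed.

(** The Cauchy-Schwarz inequality, read off from the triangle inequality. *)
Lemma dot_le_norm u v : dot U u v <= `|u| * `|v|.
Proof.
have : `|u + v| ^+ 2 <= (`|u| + `|v|) ^+ 2.
  by rewrite ler_pXn2r// ?nnegrE ?addr_ge0//; exact: ler_normD.
by rewrite dot_norm_sqrD sqrrD; lra.
Qed.

(** For [0 < eps], a homeomorphism onto the open ball of radius [eps] about the
origin. *)
Definition to_ball eps v : U := (eps / (1 + `|v|)) *: v.

Lemma norm_to_ball eps v : 0 < eps -> `|to_ball eps v| < eps.
Proof.
move=> e0; rewrite normrZ ger0_norm; last by rewrite divr_ge0 ?addr_ge0// ltW.
by rewrite mulrAC ltr_pdivrMr ?ltr_wpDr// mulrDr mulr1; lra.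
Qed.

Lemma to_ball_act eps (g : gT) v :
  to_ball eps (rep_act g v) = rep_act g (to_ball eps v).
Proof. by rewrite /to_ball rep_act_norm linearZ. Qed.

(** The map [v / (1 + |v|)] is 2-Lipschitz by a direct estimate, which is enough
once [eps] is at most [1/2]. *)
Lemma to_ball_dist eps v w : 0 <= eps -> eps *+ 2 <= 1 ->
  `|to_ball eps v - to_ball eps w| <= `|v - w|.
Proof.
move=> e0 e1.
have v0 := normr_ge0 v; have w0 := normr_ge0 w.
have av : 0 < 1 + `|v| by lra.
have aw : 0 < 1 + `|w| by lra.
have -> : to_ball eps v - to_ball eps w =
    (eps / (1 + `|v|)) *: (v - w) +
    (eps * (`|w| - `|v|) / ((1 + `|v|) * (1 + `|w|))) *: w.
  rewrite /to_ball scalerBr -addrA; congr (_ + _).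
  rewrite -!(scaleNr _ w) -scalerDl; congr (_ *: _).
  by field; rewrite !gt_eqF.
apply: le_trans (ler_normD _ _) _; rewrite !normrZ.
have h : `| `|w| - `|v| | <= `|v - w|.
  by rewrite distrC; exact: ler_dist_dist.
rewrite !normfV !normrM !(gtr0_norm av) !(gtr0_norm aw) ger0_norm//.
have vw0 := normr_ge0 (v - w).
have h1 : eps / (1 + `|v|) * `|v - w| <= eps * `|v - w|.
  by rewrite ler_wpM2r// ler_pdivrMr// ler_peMr//; lra.
suff h2 : eps * `| `|w| - `|v| | / ((1 + `|v|) * (1 + `|w|)) * `|w| <=
    eps * `|v - w| by nra.
rewrite mulrAC ler_pdivrMr ?mulr_gt0// -!mulrA ler_wpM2l//.
by apply: ler_pM => //; nra.
Qed.

(** Quantitative strict monotonicity.  The two sides differ by a multiple of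
[|v| |w| - <v, w>], so this is Cauchy-Schwarz once more.  Unlike a lower bound
on the distance, it survives taking convex combinations with the identity. *)
Lemma to_ball_monotone eps v w : 0 <= eps ->
  eps * `|v - w| ^+ 2 / ((1 + `|v|) * (1 + `|w|)) <=
  dot U (to_ball eps v - to_ball eps w) (v - w).
Proof.
move=> e0.
have v0 := normr_ge0 v; have w0 := normr_ge0 w.
have av : 0 < 1 + `|v| by lra.
have aw : 0 < 1 + `|w| by lra.
rewrite -subr_ge0.
suff -> : dot U (to_ball eps v - to_ball eps w) (v - w) -
    eps * `|v - w| ^+ 2 / ((1 + `|v|) * (1 + `|w|)) =
    eps * (`|v| + `|w|) * (`|v| * `|w| - dot U v w) /
    ((1 + `|v|) * (1 + `|w|)).
  apply: divr_ge0; last by rewrite mulr_ge0// ltW.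
  apply: mulr_ge0; last by rewrite subr_ge0 dot_le_norm.
  by rewrite mulr_ge0// addr_ge0.
rewrite dot_norm_sqrB linearBl linearBr linearBr /= !dotZl /=.
rewrite !dot_norm (dotC w v).
by field; rewrite !gt_eqF.
Qed.

(** A path of self-maps from the contraction onto the ball of radius [eps] about
[p], at [t = 0], to the identity, at [t = 1]. *)
Definition shrink eps p t v : U := (1 - t) *: (p + to_ball eps v) + t *: v.

Lemma shrinkB eps p t v w : shrink eps p t v - shrink eps p t w =
  (1 - t) *: (to_ball eps v - to_ball eps w) + t *: (v - w).
Proof.
rewrite /shrink opprD addrACA -!scalerBr; congr (_ *: _ + _).
by rewrite opprD addrACA subrr add0r.
Qed.

Lemma shrink_dist eps p t v w : 0 <= eps -> eps *+ 2 <= 1 -> 0 <= t <= 1 ->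
  `|shrink eps p t v - shrink eps p t w| <= `|v - w|.
Proof.
move=> e0 e1 /andP[t0 t1]; rewrite shrinkB.
apply: le_trans (ler_normD _ _) _; rewrite !normrZ !ger0_norm ?subr_ge0//.
have := to_ball_dist v w e0 e1; have := normr_ge0 (v - w); nra.
Qed.

(** Each map of the path is monotone with the constant of [to_ball_monotone];
dividing by [|v - w|] turns this into a lower bound on distances, from which
injectivity and openness onto the image follow. *)
Lemma shrink_expand eps p t v w : 0 <= eps -> eps *+ 2 <= 1 -> 0 <= t <= 1 ->
  eps * `|v - w| / ((1 + `|v|) * (1 + `|w|)) <=
  `|shrink eps p t v - shrink eps p t w|.
Proof.
move=> e0 e1 /andP[t0 t1].
have [->|vw] := eqVneq v w; first by rewrite !subrr normr0 mulr0 mul0r.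
have d0 : 0 < `|v - w| by rewrite normr_gt0 subr_eq0.
rewrite -(ler_pM2r d0); apply: le_trans (dot_le_norm _ _).
rewrite shrinkB dotDl !dotZl /= dot_norm.
have := to_ball_monotone v w e0; rewrite expr2 mulrA.
set D := `|v - w| in d0 *; set X := dot U _ _.
have v0 := normr_ge0 v; have w0 := normr_ge0 w.
set P := (1 + _) * (1 + _) => PX.
have P1 : 1 <= P by rewrite /P; nra.
have P0 : 0 < P by lra.
have hD : eps * D * D / P <= D * D.
  have DD0 : 0 <= D * D by rewrite -expr2 sqr_ge0.
  by rewrite ler_pdivrMr// -mulrA mulrC ler_wpM2l//; lra.
rewrite mulrAC; move: (eps * D * D / P) (D * D) PX hD => Y E; nra.
Qed.

Lemma shrink_act eps p t (g : gT) v :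
  shrink eps (rep_act g p) t (rep_act g v) = rep_act g (shrink eps p t v).
Proof.
pose f := @rep_act _ _ U g; rewrite /shrink to_ball_act.
by rewrite -/f; move: (to_ball eps v) => u; rewrite !linearD !linearZ_LR.
Qed.

Lemma shrink1 eps p v : shrink eps p 1 v = v.
Proof. by rewrite /shrink subrr scale0r add0r scale1r. Qed.

Lemma shrink0 eps p v : shrink eps p 0 v = p + to_ball eps v.
Proof. by rewrite /shrink subr0 scale0r addr0 scale1r. Qed.

Lemma shrink_continuous eps p :
  continuous (fun x : R * U => shrink eps p x.1 x.2).
Proof.
move=> [t v]; rewrite /shrink /to_ball.
apply: cvgD.
  apply: cvgZ; first by apply: cvgB; [exact: cvg_cst|exact: cvg_fst].
  apply: cvgD; first exact: cvg_cst.
  apply: cvgZ; last exact: cvg_snd.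
  apply: cvgM; first exact: cvg_cst.
  apply: cvgV; first by rewrite gt_eqF// ltr_wpDr.
  apply: cvgD; first exact: cvg_cst.
  by apply: cvg_norm; exact: cvg_snd.
by apply: cvgZ; [exact: cvg_fst|exact: cvg_snd].
Qed.

End Radial.

(** * Topological preliminaries *)

(** The hypothesis says that the inverse of [f] on its image is continuous; take
for [B] the largest open set whose preimage lies in [A]. *)
Lemma open_preimage_of_expanding (R : realType) (X Y : pseudoMetricType R)
    (f : X -> Y) :
    (forall x r, 0 < r -> exists2 d, 0 < d &
       forall x', ball (f x) d (f x') -> ball x r x') ->
  forall A : set X, open A -> exists B : set Y, open B /\ A = f @^-1` B.
Proof.
move=> f_exp A oA.
exists (\bigcup_(O in [set O | open O /\ f @^-1` O `<=` A]) O); split.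
  by apply: bigcup_open => O [].
apply/seteqP; split=> [x Ax|x [W [_ WA] Wx]]; last exact: WA.
have /nbhs_ballP[r r0 rA] : nbhs x A by exact: open_nbhs_nbhs.
have [d d0 dr] := f_exp x r r0.
exists (ball (f x) d)^°; last exact: nbhsx_ballx.
split; first exact: open_interior.
by move=> x' /interior_subset/dr; exact: rA.
Qed.

Lemma injective_family_separated (R : realType) (V : normedModType R) n
    (p : 'I_n -> V) :
    injective p ->
  exists eps : R, [/\ 0 < eps, eps *+ 2 <= 1 &
    forall i j, i != j -> eps *+ 2 <= `|p i - p j|].
Proof.
move=> p_inj.
pose m : R := \big[Order.min/1]_(ij : 'I_n * 'I_n | ij.1 != ij.2)
  `|p ij.1 - p ij.2|.
have mE : m / 2 *+ 2 = m by rewrite -mulr_natr divfK.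
exists (m / 2); rewrite mE; split.
- rewrite divr_gt0// lt_bigmin// => -[i j] /= ij.
  by rewrite normr_gt0 subr_eq0 (inj_eq p_inj).
- exact: bigmin_le_id.
- by move=> i j ij; exact: (@bigmin_le_cond _ _ _ _ (i, j)).
Qed.

(** * Configurations of Steiner paths *)

Section Steiner.
Variables (R : realType) (gT : finGroupType) (U : orep R gT).

Section Subrep.
Variable V : subrep U.

Lemma subrep_lin (a b : R) u v :
  sr_set V u -> sr_set V v -> sr_set V (a *: u + b *: v).
Proof.
have [n [e ->]] := sr_findim V => -[c _ <-] [d _ <-].
exists (fun i => a * c i + b * d i) => //.
rewrite !scaler_sumr -big_split; apply: eq_bigr => i _ /=.
by rewrite scalerDl !scalerA.
Qed.

Lemma subrep0 : sr_set V 0.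
Proof.
have [n [e ->]] := sr_findim V.
by exists (fun=> 0) => //; rewrite big1// => i _; rewrite scale0r.
Qed.

Definition subrep_zero : V := exist _ 0 (mem_set subrep0).

Lemma subrep_shrink eps p t v : 
  sr_set V p -> sr_set V v -> sr_set V (shrink eps p t v).
Proof.
move=> Vp Vv; apply: subrep_lin => //.
by rewrite -[p]scale1r; exact: subrep_lin.
Qed.

Variables (eps : R) (p : V).

Definition steiner_shrink (t : @unit_itv R) (v : V) : V :=
  exist _ (shrink eps (val p) (val t) (val v))
    (mem_set (subrep_shrink eps (val t) (set_mem (valP p)) (set_mem (valP v)))).

Hypotheses (eps_gt0 : 0 < eps) (eps_half : eps *+ 2 <= 1).

Lemma steiner_shrink_continuous :
  continuous (fun x : @unit_itv R * V => steiner_shrink x.1 x.2).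
Proof.
apply: continuous_comp_initial => -[t v].
pose g (x : @unit_itv R * V) : R * U := (val x.1, val x.2).
apply: (@continuous_comp _ _ _ g
  (fun x : R * U => shrink eps (val p) x.1 x.2)); last first.
  exact: shrink_continuous.
have ct : {for (t, v), continuous (fun x : @unit_itv R * V => val x.1 : R)}.
  apply: (@continuous_comp _ _ _ fst (set_val : @unit_itv R -> R)).
    exact: cvg_fst.
  exact: initial_continuous.
have cv : {for (t, v), continuous (fun x : @unit_itv R * V => val x.2 : U)}.
  apply: (@continuous_comp _ _ _ snd (set_val : V -> U)).
    exact: cvg_snd.
  exact: initial_continuous.
exact: (cvg_pair ct cv).
Qed.

Lemma steiner_shrink_embedding t : embR (steiner_shrink t).
Proof.
have t01 : 0 <= val t <= 1.
  by have := set_mem (valP t); rewrite /unit_itv /= in_itv.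
have eps0 := ltW eps_gt0.
have expand v w := shrink_expand (val p) v w eps0 eps_half t01.
split; last by move=> v w; exact: shrink_dist.
split.
- move=> v w /(congr1 val) /= vw; apply: val_inj.
  have := expand (val v) (val w); rewrite vw subrr normr0.
  rewrite pmulr_lle0 ?invr_gt0 ?mulr_gt0 ?ltr_wpDr//.
  by rewrite pmulr_rle0// normr_le0 subr_eq0 => /eqP.
- exact: (continuous_curry steiner_shrink_continuous).2 t.
- apply: (@open_preimage_of_expanding R V V) => v r r0.
  set a := `|val v|; have a0 : 0 <= a by exact: normr_ge0.
  pose m := Num.min r 1.
  have m0 : 0 < m by rewrite lt_min r0 ltr01.
  exists (eps * m / ((1 + a) * (2 + a))).
    by rewrite !(divr_gt0, mulr_gt0)//; lra.
  move=> w; rewrite -[ball _ _ _]/(ball (val _) _ (val _)).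
  rewrite -[ball v r w]/(ball (val v) r (val w)).
  rewrite -!ball_normE /= !ltNge; apply: contra => rd.
  apply: le_trans (expand _ _).
  have : `|val w| <= a + `|val v - val w|.
    by rewrite -{1}(subKr (val v) (val w)) (le_trans (ler_normB _ _)).
  have := normr_ge0 (val w); rewrite -/a.
  move: `|val w| `|val v - val w| rd => b d rd b0 bad.
  have m1 : m <= 1 by rewrite ge_min lexx orbT.
  have md : m <= d by rewrite (le_trans _ rd)// ge_min lexx.
  (* The bound for [v] and [w] depends on [b = |w|]; it is made uniform in [w]
     by [b <= a + d], [m <= 1] and [m <= d], where [d = |v - w|]. *)
  rewrite !invfM [leLHS]mulrACA [leRHS]mulrACA ler_wpM2l//.
    by rewrite divr_ge0//; lra.
  rewrite ler_pdivrMr; last lra.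
  rewrite mulrAC ler_pdivlMr; last lra.
  have d0 : 0 <= d by lra.
  have : m * b <= m * (a + d) by rewrite ler_pM2l.
  have : m * a <= d * a by rewrite ler_wpM2r.
  have : m * d <= 1 * d by rewrite ler_wpM2r.
  lra.
Qed.

Lemma steiner_shrink_path : steiner_path steiner_shrink.
Proof.
split; first exact: steiner_shrink_embedding.
  exact: (continuous_curry steiner_shrink_continuous).1.
by apply/funext => v; apply: val_inj; rewrite /= shrink1.
Qed.

End Subrep.

Lemma steiner_shrink_steiner (V : subrep U) n (p : 'I_n -> V) eps :
    0 < eps -> eps *+ 2 <= 1 ->
    (forall i j, i != j -> eps *+ 2 <= `|val (p i) - val (p j)|) ->
  steiner V n (fun i => steiner_shrink eps (p i)).
Proof.
move=> e0 e1 sep; split=> [i|i j _ _ [y [[v _ <-] [w _ /(congr1 val)]]]].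
  exact: steiner_shrink_path.
rewrite /= !shrink0 => ij; apply/eqP/negPn/negP => /sep; apply/negP.
have <- : to_ball eps (val w) - to_ball eps (val v) = val (p i) - val (p j).
  by apply/eqP; rewrite subr_eq addrAC -ij addrAC subrr add0r.
rewrite -ltNge mulr2n (le_lt_trans (ler_normB _ _))//.
by rewrite ltrD// norm_to_ball.
Qed.

(** The image of the origin at time 0.  As an element of [U] it does not see the
subrepresentation: the extension of a path from [V] to [W] agrees with the path
at the origin of [V].  Hence it is an invariant of points of the colimit. *)
Definition steiner_center n (x : steiner_rep U n) (i : 'I_n) : U :=
  val (val (srep_val x) i (I0 R) (subrep_zero (srep_space x))).

Lemma steiner_center_inj n (x : steiner_rep U n) : injective (steiner_center x).
Proof.
move=> i j /val_inj ij; have [_ disj] := set_mem (valP (srep_val x)).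
apply: disj => //; exists (val (srep_val x) i (I0 R) (subrep_zero _)).
by split; [exists (subrep_zero _)|rewrite ij; exists (subrep_zero _)].
Qed.

Lemma steiner_center_eqv n (x y : steiner_rep U n) :
  clos_refl_sym_trans _ (@steiner_extends R gT U n) x y ->
  steiner_center x = steiner_center y.
Proof.
elim=> [{}x {}y [_ xy]|//|{}x {}y _ ->//|{}x {}y z _ -> _ ->//].
apply/funext => i; rewrite /steiner_center.
rewrite (xy i (I0 R) (subrep_zero _) (subrep_zero _) (subrep_zero _)) ?addr0//.
by move=> v; rewrite linear0l.
Qed.

Lemma steiner_center_act n g (tau : 'S_n) (x : steiner_rep U n) i :
  steiner_center (steiner_rep_act g tau x) (tau i) =
  rep_act g (steiner_center x i).
Proof.
rewrite /steiner_center /= permK; congr (rep_act _ _).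
by congr (val (val (srep_val x) i _ _)); apply: val_inj; rewrite /= linear0.
Qed.

(** * The transfer system of a Steiner operad *)

Section OrbitSpan.
Variable x : U.

Definition orbit_span_set : set U :=
  [set \sum_(i < #|gT|) c i *: rep_act (enum_val i) x |
    c in [set: 'I_#|gT| -> R]].

Lemma orbit_span_findim : exists n (e : 'I_n -> U),
  orbit_span_set = [set \sum_i c i *: e i | c in [set: 'I_n -> R]].
Proof. by exists #|gT|, (fun i => rep_act (enum_val i) x). Qed.

Lemma orbit_span_act g v : orbit_span_set v -> orbit_span_set (rep_act g v).
Proof.
move=> [c _ <-].
pose f (i : 'I_#|gT|) : 'I_#|gT| := enum_rank (g^-1 * enum_val i)%g.
exists (c \o f) => //; rewrite linear_sum.
have f_inj : injective f.
  by move=> i j /enum_rank_inj /mulgI /enum_val_inj.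
rewrite [RHS](reindex_inj f_inj); apply: eq_bigr => i _ /=.
by rewrite linearZ_LR /f enum_rankK -rep_actM mulKVg.
Qed.

Definition orbit_span : subrep U := Subrep orbit_span_findim orbit_span_act.

Lemma mem_orbit_span g : sr_set orbit_span (rep_act g x).
Proof.
exists (fun i => (i == enum_rank g)%:R) => //.
rewrite (bigD1 (enum_rank g))//= eqxx scale1r enum_rankK big1 ?addr0// => i.
by move=> /negPf ->; rewrite scale0r.
Qed.

End OrbitSpan.

(** A point of [U] with stabilizer [K] in [H] is the same as an injective
[H]-map from [H/K] to [U].  A fixed configuration gives such a map through its
centers, and such a map is realized by the centers of the paths
[steiner_shrink]. *)
Theorem steiner_transferP (K H : {group gT}) :
  transfer_of (steiner_operad U) K H <->
  K \subset H /\
    exists x : U, forall h, h \in H -> (rep_act h x = x <-> h \in K).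
Proof.
split=> [[KH [s [[e [e_inj eim eE]] [q qE]]]]|[KH [x xE]]]; split=> //.
  have : (1%g *: K)%g \in lcosets K H by apply/lcosetsP; exists 1%g.
  rewrite -eim => /imsetP[i _]; rewrite lcoset1 => iE.
  exists (steiner_center (generic_quotient.repr q) i) => h hH.
  have hc := steiner_center_act h (s h) (generic_quotient.repr q) i.
  have sc : steiner_center (steiner_rep_act h (s h) (generic_quotient.repr q)) =
      steiner_center (generic_quotient.repr q).
    apply: steiner_center_eqv; apply/asboolP.
    apply/(@eqmodP _ (steiner_eqv_rel U _)).
    rewrite reprK -[RHS](qE h hH).
    by rewrite /= -{2}[q]reprK steiner_colim_actE.
  rewrite -hc sc; split=> [/steiner_center_inj si|hK].
    have := eE h hH i; rewrite si -iE => KE.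
    by have := lcoset_refl K h; rewrite -KE.
  apply: congr1; apply: e_inj; rewrite eE// -iE.
  exact: lcoset_id.
have [s sP] := coset_perm_rep_exists K H; exists s; split=> //.
have [e [e_inj eim eE]] := sP.
have eP i : exists2 y, y \in H & e i = (y *: K)%g.
  have : e i \in lcosets K H by rewrite -eim; apply/imsetP; exists i.
  by move=> /lcosetsP[y yH ->]; exists y.
(* [K] fixes [x], so the value at [x] of a representative depends only on its
   coset. *)
pose q (A : {set gT}) := rep_act (repr A) x.
have qE y : y \in H -> q (y *: K)%g = rep_act y x.
  move=> yH; rewrite /q.
  have /lcosetP[k kK ->] := mem_repr _ (lcoset_refl K y).
  rewrite rep_actM; congr (rep_act y _).
  by apply/xE => //; exact: fintype.subsetP KH _ kK.
have q_inj : injective (q \o e).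
  move=> i j /=; have [y yH yE] := eP i; have [z zH zE] := eP j.
  rewrite yE zE !qE// => yz; apply: e_inj; rewrite yE zE.
  apply/esym/lcoset_eqP; rewrite mem_lcoset; apply/xE.
    by rewrite groupM ?groupV.
  by rewrite rep_actM -yz rep_actK.
have [eps [eps0 eps1 sep]] := injective_family_separated q_inj.
pose V := orbit_span x.
pose p i : V := exist _ (q (e i)) (mem_set (mem_orbit_span x (repr (e i)))).
have pP := mem_set (@steiner_shrink_steiner V _ p eps eps0 eps1 sep).
pose c : steiner_rep U #|H : K|%g :=
  SteinerRep (exist (fun f => f \in steiner V _) _ pP).
exists (\pi_(steiner_colim U _)%qT c) => h hH.
rewrite /= steiner_colim_actE; congr (\pi_(_)%qT _).
rewrite /steiner_rep_act; congr SteinerRep.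
apply: val_inj; apply/funext => i; apply/funext => t; apply/funext => v.
apply: val_inj => /=.
rewrite -shrink_act rep_actVK; congr (shrink _ _ _ _).
have [y yH yE] := eP ((s h)^-1 i)%g.
rewrite yE qE// -rep_actM -qE ?groupM// lcosetM -yE -eE//.
by rewrite permKV.
Qed.
End Steiner.

Lemma stabilizer_group (R : realType) (gT : finGroupType) (U : orep R gT)
    (x : U) :
  exists S : {group gT}, forall g, g \in S <-> rep_act g x = x.
Proof.
pose A : {set gT} := [set g | `[< rep_act g x = x >] ]%SET.
have gA : group_set A.
  apply/group_setP; split=> [|g h].
    by rewrite inE; apply/asboolP; rewrite rep_act1.
  by rewrite !inE => gx hx; rewrite rep_actM hx.
by exists (Group gA) => g; rewrite [g \in _]inE; split=> /asboolP.
Qed.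

(** * Neither kind of operad realizes the generated transfer system *)

Theorem theorem4p3 (R : realType) (gT : finGroupType) (K L H : {group gT})
    (nKG : normal K [set: gT]%SET) (ltKL : K \proper L) (ltLH : L \proper H)
    (ltHG : H \proper [set: gT]%SET) (U : orep R gT) (hU : is_universe U) :
  generated_ts (pair_rel K H) <> transfer_of (steiner_operad U) /\
  generated_ts (pair_rel K H) <> transfer_of (linear_isometries_operad U).
Proof.
have ltKH := proper_trans ltKL ltLH; have KH := proper_sub ltKH.
have genKH : generated_ts (pair_rel K H) K H by move=> T _; apply.
split=> E.
- have /steiner_transferP[_ [x xH]] : transfer_of (steiner_operad U) K H.
    by rewrite -E.
  have [S SE] := stabilizer_group x.
  have : transfer_of (steiner_operad U) S [set: gT]%G.
    apply/steiner_transferP; split; first exact: finset.subsetT.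
    by exists x => g _; rewrite SE.
  rewrite -E => /(generated_pairP KH)[ST|[_ [g]]].
    case/proper_subn/negP: ltKH; apply/fintype.subsetP => h hH.
    by apply/xH => //; apply/SE; rewrite ST inE.
  rewrite finset.subTset => /eqP /(congr1 (fun A : {set gT} => #|A|)).
  rewrite cardJg => HT; have := proper_card ltHG.
  by rewrite HT ltnn.
- have : transfer_of (linear_isometries_operad U) L H.
    apply: (lin_isom_saturated (proper_sub ltKL) (proper_sub ltLH)).
    by rewrite -E.
  rewrite -E => /(generated_pairP KH)[LH|[[g LK] _]].
    by move: ltLH; rewrite LH fintype.properxx.
  have := subset_leq_card LK; rewrite cardJg leqNgt.
  by rewrite proper_card.
Qed.
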